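(* Let $H$ be a graph. The class of $H$-free graphs is bounded-apex-chordal if and only if $H$ is an induced subgraph of $P_3$.
   Context: All graphs are finite and simple. $P_3$ is the path on three vertices. ''Induced subgraph of $X$'' means isomorphic to $X[S]$ for some $S\subseteq V(X)$. A graph is $H$-free if none of its induced subgraphs is isomorphic to $H$. A graph is chordal if it has no induced cycle on four or more vertices. A class of graphs is bounded-apex-chordal if there is a constant $c\in\mathbb{N}$ such that every graph $G$ in the class has a set $S\subseteq V(G)$ with $|S|\le c$ such that $G-S$ is chordal. *)

(* Defs.v *)
From mathcomp Require Import all_boot.
Set Implicit Arguments.
Unset Strict Implicit.
Unset Printing Implicit Defensive.

(* Finite simple graphs; the graph with no vertices is allowed. *)
Record sgraph := SGraph {
  vertex :> finType;
  edge : rel vertex;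
  edge_sym : symmetric edge;
  edge_irrefl : irreflexive edge
}.

Definition isomorphic (G H : sgraph) : Prop :=
  exists f : G -> H, bijective f /\ forall x y, edge (f x) (f y) = edge x y.

Section Induced.
Variables (G : sgraph) (S : {set G}).

Definition induced_edge : rel {x : G | x \in S} :=
  fun x y => edge (val x) (val y).

Fact induced_edge_sym : symmetric induced_edge.
Proof. by move=> x y; apply: edge_sym. Qed.

Fact induced_edge_irrefl : irreflexive induced_edge.
Proof. by move=> x; apply: edge_irrefl. Qed.

Definition induced : sgraph := SGraph induced_edge_sym induced_edge_irrefl.

End Induced.

Definition delete (G : sgraph) (S : {set G}) : sgraph := induced (~: S).

Definition induced_subgraph (H X : sgraph) : Prop :=
  exists S : {set X}, isomorphic H (induced S).

Definition H_free (H G : sgraph) : Prop := ~ induced_subgraph H G.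

Definition path_edge n : rel 'I_n :=
  fun i j => (j == i.+1 :> nat) || (i == j.+1 :> nat).

Fact path_edge_sym n : symmetric (@path_edge n).
Proof. by move=> i j; rewrite /path_edge orbC. Qed.

Fact path_edge_irrefl n : irreflexive (@path_edge n).
Proof. by move=> i; rewrite /path_edge orbb ltn_eqF. Qed.

Definition path_graph n : sgraph :=
  SGraph (@path_edge_sym n) (@path_edge_irrefl n).

(* ordS is the cyclic successor on 'I_n; the conjunct i != j only matters for
   n = 1, where it removes the loop. This is the n-cycle for n >= 3. *)
Definition cycle_edge n : rel 'I_n :=
  fun i j => (i != j) && ((j == ordS i) || (i == ordS j)).

Fact cycle_edge_sym n : symmetric (@cycle_edge n).
Proof. by move=> i j; rewrite /cycle_edge eq_sym orbC. Qed.

Fact cycle_edge_irrefl n : irreflexive (@cycle_edge n).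
Proof. by move=> i; rewrite /cycle_edge eqxx. Qed.

Definition cycle_graph n : sgraph :=
  SGraph (@cycle_edge_sym n) (@cycle_edge_irrefl n).

Definition chordal (G : sgraph) : Prop :=
  forall n, 4 <= n -> ~ induced_subgraph (cycle_graph n) G.

Definition bounded_apex_chordal (C : sgraph -> Prop) : Prop :=
  exists c : nat, forall G : sgraph, C G ->
    exists S : {set G}, #|S| <= c /\ chordal (delete S).

(* Main.v *)
Require Import Defs.
From mathcomp Require Import all_boot.

(** If [H] is an induced subgraph of [P_3], an [H]-free graph has no induced
    [P_3]; every cycle of length at least four contains an induced [P_3], so the
    graph is already chordal and nothing has to be deleted.

    Conversely, let [c] bound the number of deletions for [H]-free graphs.  A
    graph partitioned into [c + 1] blocks, each inducing a cycle of length at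
    least four, keeps one block intact whenever [c] vertices are deleted
    ([cycle_blocks_not_apex_chordal]), so it is not [H]-free.  Two such graphs
    are enough to pin down [H]:
    - in the join of [c + 1] four-cycles, which is a complete multipartite graph
      with parts of size two, a vertex has at most one non-neighbour;
    - the disjoint union of [c + 1] five-cycles has no triangle and no induced
      four-cycle.
    Both properties pass to [H], and [embeds_in_P3] shows that together they
    leave only the induced subgraphs of [P_3]. *)

Set Implicit Arguments.
Unset Strict Implicit.
Unset Printing Implicit Defensive.

Definition embedding (G X : sgraph) (f : G -> X) : Prop :=
  injective f /\ forall x y, edge (f x) (f y) = edge x y.

Lemma induced_subgraphP (G X : sgraph) :
  induced_subgraph G X <-> exists f : G -> X, embedding f.
Proof.
split=> [[S [f [f_bij f_edge]]]|[f [f_inj f_edge]]].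
  exists (fun x => val (f x)); split=> [x y /val_inj|x y].
    exact: (bij_inj f_bij).
  exact: f_edge.
pose S := [set f x | x in [set: G]].
have fS x : f x \in S by apply: imset_f.
pose g x : induced S := exist _ (f x) (fS x).
exists S, g; split=> //.
have g_inj : injective g by move=> x y [] /f_inj.
apply: (inj_card_bij g_inj); rewrite card_sig.
by rewrite (eq_card (B := S)) // card_imset // cardsT.
Qed.

Lemma induced_subgraph_trans (G X Y : sgraph) :
  induced_subgraph G X -> induced_subgraph X Y -> induced_subgraph G Y.
Proof.
move=> /induced_subgraphP [f [f_inj f_edge]] /induced_subgraphP [g [g_inj g_edge]].
apply/induced_subgraphP; exists (g \o f); split=> [|x y]; first exact: inj_comp.
by rewrite /= g_edge.
Qed.

Lemma induced_is_induced_subgraph (G : sgraph) (S : {set G}) :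
  induced_subgraph (induced S) G.
Proof. by apply/induced_subgraphP; exists val; split=> // x y /val_inj. Qed.

(** A search through the finitely many maps decides whether an embedding exists,
    which turns the failure of [H_free] into an actual embedding without any
    appeal to excluded middle. *)
Lemma not_H_free (H G : sgraph) : ~ H_free H G -> induced_subgraph H G.
Proof.
pose b := [exists f : {ffun H -> G},
  injectiveb f && [forall x, forall y, edge (f x) (f y) == edge x y]].
have bP : b -> induced_subgraph H G.
  case/existsP=> f /andP [/injectiveP f_inj /forallP f_edge].
  apply/induced_subgraphP; exists f; split=> // x y.
  by apply/eqP; have /forallP := f_edge x.
move=> notfree; apply/bP; apply: contraT => /negP nb; case: notfree.
move=> /induced_subgraphP [f [f_inj f_edge]]; apply: nb.
apply/existsP; exists [ffun x => f x]; apply/andP; split.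
  by apply/injectiveP => x y; rewrite !ffunE => /f_inj.
by apply/forallP => x; apply/forallP => y; rewrite !ffunE f_edge.
Qed.

(** The path consists of the vertices 0, 1, 2: from length four on, the cyclic
    successor of 2 is no longer 0, so the ends of the path are not adjacent. *)
Lemma P3_in_long_cycle n :
  4 <= n -> induced_subgraph (path_graph 3) (cycle_graph n).
Proof.
case: n => [|[|[|[|k]]]] // _; apply/induced_subgraphP.
have le3 : 3 <= k.+4 by [].
exists (widen_ord le3); split=> [x y /(congr1 val) /= xy|]; first exact: val_inj.
move=> [i lti] [j ltj]; rewrite /= /cycle_edge /path_edge -!val_eqE /=.
have small a : a < 3 -> a.+1 %% k.+4 = a.+1.
  by move=> lta; rewrite modn_small // ltnS (leq_trans lta).
rewrite !small //.
by case: i lti => [|[|[|]]] //; case: j ltj => [|[|[|]]].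
Qed.

(** * Blocks of cycles *)

(** Joins and disjoint unions of cycles share this definition because deleting
    vertices only interacts with the edges inside a block; the flag [b] decides
    whether different blocks are completely joined or not joined at all. *)
Section CycleBlocks.
Variables (b : bool) (n m : nat).

Definition cycle_blocks_edge : rel ('I_n * 'I_m) :=
  fun u v => if u.1 == v.1 then cycle_edge u.2 v.2 else b.

Lemma cycle_blocks_edge_sym : symmetric cycle_blocks_edge.
Proof.
by move=> u v; rewrite /cycle_blocks_edge eq_sym; case: ifP => // _;
   apply: cycle_edge_sym.
Qed.

Lemma cycle_blocks_edge_irrefl : irreflexive cycle_blocks_edge.
Proof. by move=> u; rewrite /cycle_blocks_edge eqxx cycle_edge_irrefl. Qed.

Definition cycle_blocks : sgraph :=
  SGraph cycle_blocks_edge_sym cycle_blocks_edge_irrefl.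

(** Fewer than [n] vertices cannot meet all [n] blocks, and a block that they
    miss is an induced cycle. *)
Lemma cycle_blocks_not_apex_chordal (S : {set cycle_blocks}) :
  4 <= m -> #|S| < n -> ~ chordal (delete S).
Proof.
move=> m4 Sn chS; apply: (chS _ m4).
pose I := [set u.1 | u in S].
have [i iI] : exists i, i \notin I.
  apply/existsP; rewrite -negb_forall; apply/negP => /forallP allI.
  have : n <= #|I|.
    by rewrite -{1}(card_ord n) -cardsT subset_leq_card //; apply/subsetP.
  by rewrite leqNgt (leq_ltn_trans (leq_imset_card _ _) Sn).
have iS a : ((i, a) : cycle_blocks) \in ~: S.
  by rewrite inE; apply: contra iI => iaS; apply/imsetP; exists (i, a).
apply/induced_subgraphP.
exists (fun a => exist _ ((i, a) : cycle_blocks) (iS a) : delete S).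
split=> [a a' []//|a a'].
by rewrite /= /induced_edge /= /cycle_blocks_edge /= eqxx.
Qed.

Lemma induced_in_cycle_blocks (H : sgraph) c :
  (forall G, H_free H G ->
     exists S : {set G}, #|S| <= c /\ chordal (delete S)) ->
  4 <= m -> c < n -> induced_subgraph H cycle_blocks.
Proof.
move=> Hc m4 cn; apply: not_H_free => /Hc [S [Sc]].
by apply: cycle_blocks_not_apex_chordal => //; apply: leq_ltn_trans cn.
Qed.

End CycleBlocks.

(** * Local restrictions on the excluded graph *)

Definition one_nonneighbour (G : sgraph) : Prop :=
  forall x y z : G, y != x -> z != x -> ~~ edge x y -> ~~ edge x z -> y = z.

Definition triangle_free (G : sgraph) : Prop :=
  forall x y z : G, edge x y -> edge y z -> ~~ edge x z.

(** On a triangle-free graph this forbids exactly the induced four-cycles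
    [x z y w], since the diagonals [x y] and [z w] cannot be edges. *)
Definition one_common_neighbour (G : sgraph) : Prop :=
  forall x y z w : G,
    x != y -> edge x z -> edge y z -> edge x w -> edge y w -> z = w.

Lemma cycle4_one_nonneighbour : one_nonneighbour (cycle_graph 4).
Proof.
by move=> [[|[|[|[|x]]]] ltx] // [[|[|[|[|y]]]] lty] // [[|[|[|[|z]]]] ltz] //
   _ _ _ _; apply/val_inj.
Qed.

Lemma cycle5_triangle_free : triangle_free (cycle_graph 5).
Proof.
by move=> [[|[|[|[|[|x]]]]] ltx] // [[|[|[|[|[|y]]]]] lty] //
  [[|[|[|[|[|z]]]]] ltz].
Qed.

Lemma cycle5_one_common_neighbour : one_common_neighbour (cycle_graph 5).
Proof.
by move=> [[|[|[|[|[|x]]]]] ltx] // [[|[|[|[|[|y]]]]] lty] //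
  [[|[|[|[|[|z]]]]] ltz] // [[|[|[|[|[|w]]]]] ltw] // *; apply/val_inj.
Qed.

Lemma join_one_nonneighbour n m :
  one_nonneighbour (cycle_graph m) -> one_nonneighbour (cycle_blocks true n m).
Proof.
move=> Cm [i x] [j y] [k z] /=; rewrite /cycle_blocks_edge /=.
case: (i =P j) => // <-; case: (i =P k) => // <-; rewrite !xpair_eqE eqxx /=.
by move=> yx zx nxy nxz; rewrite (Cm x y z).
Qed.

Lemma disjoint_triangle_free n m :
  triangle_free (cycle_graph m) -> triangle_free (cycle_blocks false n m).
Proof.
move=> Cm [i x] [j y] [k z] /=; rewrite /cycle_blocks_edge /=.
by case: eqP => // <-; case: eqP => // _; apply: Cm.
Qed.

Lemma disjoint_one_common_neighbour n m :
  one_common_neighbour (cycle_graph m) ->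
  one_common_neighbour (cycle_blocks false n m).
Proof.
move=> Cm [i x] [j y] [k z] [l w] /=; rewrite /cycle_blocks_edge /=.
case: (i =P k) => // <-; case: (j =P i) => // ->; case: (i =P l) => // <-.
by rewrite xpair_eqE eqxx /= => xy xz yz xw yw; rewrite (Cm x y z w).
Qed.

Section Hereditary.
Variables (H G : sgraph) (HG : induced_subgraph H G).

Lemma one_nonneighbour_induced : one_nonneighbour G -> one_nonneighbour H.
Proof.
move/induced_subgraphP: HG => [f [f_inj f_edge]] PG x y z yx zx nxy nxz.
by apply/f_inj/(PG (f x)); rewrite ?f_edge ?(inj_eq f_inj).
Qed.

Lemma triangle_free_induced : triangle_free G -> triangle_free H.
Proof.
move/induced_subgraphP: HG => [f [_ f_edge]] PG x y z xy yz.
by rewrite -f_edge; apply: PG (f y) _ _ _; rewrite f_edge.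
Qed.

Lemma one_common_neighbour_induced :
  one_common_neighbour G -> one_common_neighbour H.
Proof.
move/induced_subgraphP: HG => [f [f_inj f_edge]] PG x y z w xy xz yz xw yw.
by apply/f_inj/(PG (f x) (f y)); rewrite ?f_edge ?(inj_eq f_inj).
Qed.

End Hereditary.

(** If [x] and [y] are distinct and non-adjacent, every other vertex is adjacent
    to both, so it is a common neighbour and there is at most one: [x] and [y]
    go to the ends of the path and it goes to the middle.  Otherwise [H] is
    complete, and being triangle-free it has at most two vertices. *)
Lemma embeds_in_P3 (H : sgraph) :
  one_nonneighbour H -> triangle_free H -> one_common_neighbour H ->
  induced_subgraph H (path_graph 3).
Proof.
move=> nonnb tri common; apply/induced_subgraphP.
pose p0 : path_graph 3 := @Ordinal 3 0 isT.
pose p1 : path_graph 3 := @Ordinal 3 1 isT.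
pose p2 : path_graph 3 := @Ordinal 3 2 isT.
have [[x y] /= /andP [xy nxy]|complete] :=
  @pickP (H * H)%type [pred p | (p.1 != p.2) && ~~ edge p.1 p.2].
  have nyx : ~~ edge y x by rewrite edge_sym.
  have adjx z : z != x -> z != y -> edge x z.
    move=> zx zy; apply: contraNT zy => nxz.
    by rewrite (nonnb x z y) // eq_sym.
  have adjy z : z != x -> z != y -> edge y z.
    move=> zx zy; apply: contraNT zx => nyz.
    by rewrite (nonnb y z x).
  have middle z w : z != x -> z != y -> w != x -> w != y -> z = w.
    by move=> zx zy wx wy; apply: (common x y); rewrite ?adjx ?adjy.
  exists (fun v => if v == x then p0 else if v == y then p2 else p1).
  split=> v w.
    case: (eqVneq v x) => [?|vx]; case: (eqVneq w x) => [?|wx];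
      case: (eqVneq v y) => [?|vy]; case: (eqVneq w y) => [?|wy];
      move=> /(congr1 val) //= _; subst=> //.
    exact: middle.
  case: (eqVneq v x) => [->|vx]; case: (eqVneq w x) => [->|wx].
  - by rewrite !edge_irrefl.
  - by case: (eqVneq w y) => [->|wy]; rewrite ?(negPf nxy) ?adjx.
  - by rewrite edge_sym [RHS]edge_sym;
       case: (eqVneq v y) => [->|vy]; rewrite ?(negPf nxy) ?adjx.
  case: (eqVneq v y) => [->|vy]; case: (eqVneq w y) => [->|wy].
  - by rewrite !edge_irrefl.
  - by rewrite adjy.
  - by rewrite [RHS]edge_sym adjy.
  - by rewrite (middle v w) // !edge_irrefl.
have adj (x y : H) : x != y -> edge x y.
  by move=> xy; have := complete (x, y); rewrite /= xy /= => /negbFE.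
have [x _|H0] := pickP (@predT H); last first.
  by exists (fun _ => p0); split=> x; have := H0 x.
have other v w : v != x -> w != x -> v = w.
  move=> vx wx; apply/eqP; apply: contraT => vw.
  have := tri v x w (adj _ _ vx).
  by rewrite adj ?(eq_sym x) // adj // => /(_ isT).
exists (fun v => if v == x then p0 else p1); split=> v w.
  case: (eqVneq v x) => [->|vx]; case: (eqVneq w x) => [->|wx] // _.
  exact: other.
case: (eqVneq v x) => [->|vx]; case: (eqVneq w x) => [->|wx];
  rewrite ?edge_irrefl //=.
- by rewrite adj // eq_sym.
- by rewrite adj.
- by rewrite (other v w) // !edge_irrefl.
Qed.

Theorem theorem6p1 (H : sgraph) :
  bounded_apex_chordal (H_free H) <-> induced_subgraph H (path_graph 3).
Proof.
split=> [[c Hc]|HP3].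
  have Hjoin := induced_in_cycle_blocks true Hc (isT : 4 <= 4) (leqnn c.+1).
  have Hdisj := induced_in_cycle_blocks false Hc (isT : 4 <= 5) (leqnn c.+1).
  apply: embeds_in_P3.
  - apply: one_nonneighbour_induced Hjoin _.
    exact/join_one_nonneighbour/cycle4_one_nonneighbour.
  - apply: triangle_free_induced Hdisj _.
    exact/disjoint_triangle_free/cycle5_triangle_free.
  - apply: one_common_neighbour_induced Hdisj _.
    exact/disjoint_one_common_neighbour/cycle5_one_common_neighbour.
exists 0 => G freeG; exists set0; rewrite cards0; split=> // n n4 Cn; apply: freeG.
apply: induced_subgraph_trans HP3 _.
apply: induced_subgraph_trans (P3_in_long_cycle n4) _.
exact: induced_subgraph_trans Cn (induced_is_induced_subgraph _).
Qed.
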